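(* If $\mathcal{F}$ is a finite set of graphs, none of which is a willow, then the class of $\mathcal{F}$-free graphs is not Pollyanna.
   Context: Graphs are finite and simple. For a positive integer $n$, a graph $G$ is an $n$-willow if there exists an oriented tree $T$ (an orientation of a tree) with $V(G)\subseteq V(T)$ such that for all distinct $u,v\in V(G)$, $u$ and $v$ are adjacent in $G$ if and only if $T$ has a directed path from $u$ to $v$ or from $v$ to $u$ whose length (number of edges) is not a multiple of $n$. A graph is a willow if it is an $n$-willow for some positive integer $n$. A graph is $\mathcal F$-free if it has no induced subgraph isomorphic to a member of $\mathcal F$. A class $\mathcal F'$ of graphs is $\chi$-bounded (resp. polynomially $\chi$-bounded) if there is a function (resp. polynomial) $f$ with $\chi(H)\le f(\omega(H))$ for every induced subgraph $H$ of every graph in $\mathcal F'$. A class $\mathcal C$ is Pollyanna if $\mathcal C\cap\mathcal F'$ is polynomially $\chi$-bounded for every $\chi$-bounded class $\mathcal F'$. *)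

(* Defs.v *)
From HB Require Import structures.
From mathcomp Require Import all_boot all_order all_algebra.
From Stdlib Require Rdefinitions.
From mathcomp Require Import Rstruct.

Set Implicit Arguments.
Unset Strict Implicit.
Unset Printing Implicit Defensive.

Import Order.TTheory GRing.Theory Num.Theory.

Record sgraph := SGraph {
  vertex :> finType;
  edge : rel vertex;
  edge_sym : symmetric edge;
  edge_irrefl : irreflexive edge }.

Arguments edge {s}.

Definition isomorphic (G H : sgraph) : Prop :=
  exists2 f : G -> H, bijective f & forall u v, edge (f u) (f v) = edge u v.

Section InducedSubgraph.
Variables (G : sgraph) (S : {set G}).

Definition induced_edge : rel {x : G | x \in S} :=
  fun u v => edge (val u) (val v).

Lemma induced_edge_sym : symmetric induced_edge.
Proof. by move=> u v; apply: edge_sym. Qed.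

Lemma induced_edge_irrefl : irreflexive induced_edge.
Proof. by move=> u; apply: edge_irrefl. Qed.

Definition induced : sgraph := SGraph induced_edge_sym induced_edge_irrefl.

End InducedSubgraph.

Definition colorable (G : sgraph) (k : nat) : bool :=
  [exists c : {ffun G -> 'I_k}, forall u, forall v, edge u v ==> (c u != c v)].

Lemma colorable_card (G : sgraph) : exists k, colorable G k.
Proof.
exists #|G|; apply/existsP; exists [ffun x => enum_rank x].
apply/forallP=> u; apply/forallP=> v; apply/implyP=> uv.
rewrite !ffunE; apply/eqP=> /enum_rank_inj eq_uv.
by rewrite eq_uv edge_irrefl in uv.
Qed.

Definition chi (G : sgraph) : nat := ex_minn (colorable_card G).

Definition is_clique (G : sgraph) (S : {set G}) : bool :=
  [forall u in S, forall v in S, (u != v) ==> edge u v].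

Definition omega (G : sgraph) : nat := \max_(S : {set G} | is_clique S) #|S|.

Definition is_tree (T : sgraph) : Prop :=
  [/\ 0 < #|T|,
      forall x y : T, connect edge x y
    & forall c : seq T, 2 < size c -> ~ ucycle edge c].

Definition is_orientation (T : sgraph) (arc : rel T) : Prop :=
  forall x y : T, (edge x y = arc x y || arc y x) /\ ~~ (arc x y && arc y x).

Definition dipath_length (V : finType) (arc : rel V) (x y : V) (l : nat) : Prop :=
  exists p : seq V, [/\ path arc x p, uniq (x :: p), last x p = y & size p = l].

(* The inclusion V(G) <= V(T) is rendered by an injection f. *)
Definition n_willow (n : nat) (G : sgraph) : Prop :=
  exists (T : sgraph) (arc : rel T) (f : G -> T),
    [/\ is_tree T, is_orientation arc, injective f
      & forall u v : G, u != v ->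
          (edge u v <->
           exists2 l : nat, ~~ (n %| l)
             & dipath_length arc (f u) (f v) l \/ dipath_length arc (f v) (f u) l)].

Definition willow (G : sgraph) : Prop := exists2 n : nat, 0 < n & n_willow n G.

Definition graph_class := sgraph -> Prop.

Definition free_class (F : graph_class) : graph_class :=
  fun G => ~ exists (H : sgraph) (S : {set G}), F H /\ isomorphic (induced S) H.

Definition chi_bounded (C : graph_class) : Prop :=
  exists f : nat -> nat,
    forall G, C G -> forall S : {set G}, chi (induced S) <= f (omega (induced S)).

Definition poly_chi_bounded (C : graph_class) : Prop :=
  exists p : {poly Rdefinitions.R},
    forall G, C G -> forall S : {set G},
      ((chi (induced S))%:R <= p.[(omega (induced S))%:R])%R.

Definition pollyanna (C : graph_class) : Prop :=
  forall C' : graph_class,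
    chi_bounded C' -> poly_chi_bounded (fun G => C G /\ C' G).

(* Main.v *)
Require Import Defs.
From HB Require Import structures.
From mathcomp Require Import all_boot all_order all_algebra.
From mathcomp Require Import zify Rstruct.
From Stdlib Require List.

Set Implicit Arguments.
Unset Strict Implicit.
Unset Printing Implicit Defensive.

Import Order.TTheory GRing.Theory Num.Theory.

(**
For a prime [p], a counting argument in the style of Erdős yields a digraph [D]
whose arcs go up through [2 p^p + 2] layers, whose underlying graph has huge
girth and chromatic number above [p^p]. Let [W] be the graph on the vertices of
[D] in which [u] and [v] are adjacent when a directed path of length not
divisible by [p] joins them.

- Directed paths of [D] are unique, so the vertices of a clique of [W] are at
  distinct distances modulo [p] from the lowest one: [omega W <= p].
- Let [H] be an induced subgraph of [W] with [omega H = m < p]. Sort the directed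
  paths by the vector of the [floor (j (l mod p) / p)] for [j <= m], where [l] is
  the length. A chain of [m] paths of the same class would span a clique on
  [m + 1] vertices, and there are boundedly many classes in terms of [m]; hence
  [chi H] is bounded in terms of [m] only.
- A few vertices and the directed paths between them span a forest of [D], so
  small induced subgraphs of [W] are willows and [W] is [F]-free.

As [p^p] outgrows every polynomial in [p], the graphs [W] form a chi-bounded
class of [F]-free graphs that is not polynomially chi-bounded.
*)

(** * Colourings and cliques *)

Section ColoringsAndCliques.
Variable G : sgraph.

Lemma chi_colorable : colorable G (chi G).
Proof. by rewrite /chi; case: ex_minnP. Qed.

Lemma chi_leq k : colorable G k -> chi G <= k.
Proof. by rewrite /chi; case: ex_minnP => m _ mP /mP. Qed.

Lemma colorable_map (T : finType) (c : G -> T) :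
  (forall u v, edge u v -> c u != c v) -> colorable G #|T|.
Proof.
move=> cP; apply/existsP; exists [ffun x => enum_rank (c x)].
apply/forallP=> u; apply/forallP=> v; apply/implyP=> uv.
by rewrite !ffunE (inj_eq enum_rank_inj) cP.
Qed.

Lemma chi_leqP k : chi G <= k ->
  exists c : G -> 'I_k, forall u v, edge u v -> c u != c v.
Proof.
move=> le_k; have /existsP[c /forallP cP] := chi_colorable.
exists (fun x => widen_ord le_k (c x)) => u v uv.
have /forallP/(_ v)/implyP/(_ uv) := cP u.
by apply: contra => /eqP/(congr1 val)/= /val_inj->.
Qed.

Lemma clique_leq_omega (S : {set G}) : is_clique S -> #|S| <= omega G.
Proof. by move=> Scl; rewrite /omega (bigD1 S) //= leq_maxl. Qed.

End ColoringsAndCliques.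

(** * Directed walks *)

Section Walks.
Variables (T : finType) (R : rel T).

(** Vertices may repeat; in a layered digraph they never do ([path_uniq]). *)
Definition walk l u v := [exists q : l.-tuple T, path R u q && (last u q == v)].

Lemma walkP l u v :
  reflect (exists q, [/\ path R u q, last u q = v & size q = l]) (walk l u v).
Proof.
apply: (iffP existsP) => [[q /andP[qP /eqP qv]]|[q [qP qv /eqP sq]]].
  by exists q; rewrite size_tuple.
by exists (Tuple sq); rewrite qP qv eqxx.
Qed.

Lemma walk_cat l l' u v w : walk l u v -> walk l' v w -> walk (l + l') u w.
Proof.
move=> /walkP[q [qP qv <-]] /walkP[q' [qP' qw <-]]; apply/walkP.
by exists (q ++ q'); rewrite cat_path last_cat size_cat qP qv.
Qed.

Lemma walk1 u v : R u v -> walk 1 u v.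
Proof. by move=> uv; apply/walkP; exists [:: v]; rewrite /= uv. Qed.

Lemma walk0 u : walk 0 u u.
Proof. by apply/walkP; exists [::]. Qed.

End Walks.

Definition sym_closure (T : Type) (R : rel T) : rel T := fun x y => R x y || R y x.

Lemma sym_closure_sym (T : Type) (R : rel T) : symmetric (sym_closure R).
Proof. by move=> x y; rewrite /sym_closure orbC. Qed.

(** * Uniqueness of directed paths in layered digraphs of large girth *)

Section LayeredWalks.
Variables (V : finType) (arc : rel V) (lay : V -> nat).
Hypothesis arc_lay : forall u v, arc u v -> lay u < lay v.

Lemma path_lay u q : path arc u q -> lay u + size q <= lay (last u q).
Proof.
elim: q u => [|w q IH] u /=; first by rewrite addn0.
by case/andP=> /arc_lay uw /IH; lia.
Qed.

Lemma path_lay_lt u q w : path arc u q -> w \in q -> lay u < lay w.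
Proof.
elim: q u => [|x q IH] u //= /andP[/arc_lay ux xq].
rewrite inE => /orP[/eqP->//|/(IH _ xq)]; exact: ltn_trans.
Qed.

Lemma path_uniq u q : path arc u q -> uniq (u :: q).
Proof.
elim: q u => [|x q IH] u // uq; have /= /andP[_ /IH /= ->] := uq.
rewrite andbT; apply/negP=> /(path_lay_lt uq).
by rewrite ltnn.
Qed.

Lemma walk_lay l u v : walk arc l u v -> lay u + l <= lay v.
Proof. by case/walkP=> q [/path_lay + <- <-]. Qed.

(* Two distinct directed paths with common ends contain a cycle: follow the
   first path until it meets the second one, then return along the latter. *)
Lemma path_unique g u q1 q2 :
    (forall c, 2 < size c <= g -> ~ ucycle (sym_closure arc) c) ->
    path arc u q1 -> path arc u q2 -> last u q1 = last u q2 ->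
    size q1 + size q2 <= g -> q1 = q2.
Proof.
move=> no_cyc; elim: q1 u q2 => [|x q1 IH] u [|y q2] //.
- by move=> _ /path_lay /= le e; move: le; rewrite -e; lia.
- by move=> /path_lay /= le _ e; move: le; rewrite e; lia.
have [<-|xy] := eqVneq x y.
  move=> /= /andP[_ p1] /andP[_ p2] e le.
  by congr cons; apply: (IH x) => //; lia.
move=> p1 p2 e le; exfalso.
have hx : has (mem (y :: q2)) (x :: q1).
  apply/hasP; exists (last x q1); first exact: mem_last.
  by move: e => /= ->; exact: mem_last.
have [w [r1 [r1' [e1 wq2 hr1]]]] : exists w r1 r1',
    [/\ x :: q1 = rcons r1 w ++ r1', w \in y :: q2 & ~~ has (mem (y :: q2)) r1].
  by case: (split_find hx) => w r1 r1' ? ?; exists w, r1, r1'.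
have [r2 [r2' e2]] : exists r2 r2', y :: q2 = rcons r2 w ++ r2'.
  by case/path.splitP: wq2 => r2 r2'; exists r2, r2'.
move: p1 p2 (path_uniq p1) (path_uniq p2); rewrite e1 e2 !cat_path -!cat_cons.
rewrite !cat_uniq => /andP[p1 _] /andP[p2 _] /andP[u1 _] /andP[u2 _].
apply: (no_cyc ((u :: rcons r1 w) ++ rev r2)).
  rewrite size_cat /= size_rcons size_rev; apply/andP; split; last first.
    move: le; rewrite e1 e2 !size_cat !size_rcons; lia.
  case: r1 r2 {p1 p2 u1 u2 hr1 le} e1 e2 => [|a r1] [|b r2] /=; try lia.
  by case=> ex _ [ey _]; move: xy; rewrite ex ey eqxx.
rewrite /ucycle; apply/andP; split.
  rewrite /= rcons_cat cat_path last_rcons.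
  rewrite (sub_path _ p1) /=; last by move=> a b ab; rewrite /sym_closure ab.
  have := rev_path (sym_closure arc) u (rcons r2 w).
  rewrite last_rcons belast_rcons rev_cons => ->.
  by apply: sub_path p2 => a b ab; rewrite /sym_closure ab orbT.
rewrite cat_uniq u1 rev_uniq /=.
move: u2 => /= /andP[]; rewrite mem_rcons inE negb_or rcons_uniq.
move=> /andP[_ ur2] /andP[wr2 ->]; rewrite andbT.
apply/hasPn=> z; rewrite mem_rev => zr2; rewrite /= inE mem_rcons inE !negb_or.
rewrite (memPn ur2) ?(memPn wr2) //=; apply: contra hr1 => zr1.
by apply/hasP; exists z => //=; rewrite e2 mem_cat mem_rcons inE zr2 orbT.
Qed.

Lemma walk_unique g l1 l2 u v :
    (forall c, 2 < size c <= g -> ~ ucycle (sym_closure arc) c) ->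
    walk arc l1 u v -> walk arc l2 u v -> l1 + l2 <= g -> l1 = l2.
Proof.
move=> no_cyc /walkP[q1 [p1 e1 <-]] /walkP[q2 [p2 e2 <-]] le.
by rewrite (path_unique no_cyc p1 p2) ?e1 ?e2.
Qed.

End LayeredWalks.

(** * A sparse layered digraph of large chromatic number *)

Lemma bin_leq_expn n m : 'C(n, m) <= n ^ m.
Proof.
elim: m n => [|m IH] [|n] //.
rewrite -(leq_pmul2l (ltn0Sn m)) -mul_bin_diag expnS mulnCA.
apply: leq_mul => //; apply: leq_trans (IH n) _.
apply: leq_trans (leq_pmull _ (ltn0Sn m)).
by case: m {IH} => // m; rewrite leq_exp2r.
Qed.

(** Bernoulli's inequality [(1 + 1/a)^d >= 1 + d/a], cleared of denominators. *)
Lemma bernoulli_expn a d : a ^ d * (a + d) <= a * a.+1 ^ d.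
Proof.
elim: d => [|d IH]; first by rewrite !expn0 addn0 mul1n muln1.
have le_a : a ^ d <= a.+1 ^ d by case: d {IH} => // d; rewrite leq_exp2r.
rewrite !expnS; nia.
Qed.

Lemma expn_ratio_unbounded a q : 0 < a -> a ^ (a * q) * q <= a.+1 ^ (a * q).
Proof.
move=> a_gt0; rewrite -(leq_pmul2l a_gt0).
by apply: leq_trans (bernoulli_expn a (a * q)); nia.
Qed.

Lemma exists_subset_card (T : finType) (S : {set T}) l : l <= #|S| ->
  exists2 J : {set T}, J \subset S & #|J| = l.
Proof.
move=> le_l; exists [set x in take l (enum S)].
  by apply/subsetP=> x; rewrite inE => /mem_take; rewrite mem_enum.
rewrite cardsE (card_uniqP _) ?take_uniq ?enum_uniq // size_take -cardE.
by case: ltnP => //; lia.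
Qed.

(** * Counting samples of random pairs *)

Section RandomLayeredDigraph.
Variables K n D : nat.
Let M := D * n.
Let V := ('I_K * 'I_n)%type.
(** Independent draws with repetition, so that events are counted by products. *)
Let sample := {ffun 'I_M -> V * V}.

Definition forward_pairs (A : {set V}) : {set V * V} :=
  [set uv in setX A A | uv.1.1 < uv.2.1].

(** Of the [#|A|^2] pairs at most [#|A| * n] stay within a layer, and half of the others go up. *)
Lemma card_forward_pairs (A : {set V}) :
  2 * n <= #|A| -> n * n <= #|forward_pairs A|.
Proof.
move=> le_A.
pose same := [set uv in setX A A | uv.1.1 == uv.2.1].
have card_same : #|same| <= #|A| * n.
  pose f (uv : V * V) := (uv.1, uv.2.2).
  have f_inj : {in same &, injective f}.
    move=> [[a b] [c d]] [[a' b'] [c' d']]; rewrite !inE /=.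
    by move=> /andP[_ /eqP->] /andP[_ /eqP->] [-> -> ->].
  rewrite -(card_in_imset f_inj) -[n in _ * n]card_ord -cardsT -cardsX.
  apply/subset_leq_card/subsetP=> _ /imsetP[[u v] + ->].
  by rewrite !inE /= andbT -andbA => /andP[].
have : #|setX A A| <= #|forward_pairs A| + #|forward_pairs A| + #|same|.
  pose swap (uv : V * V) := (uv.2, uv.1).
  have le_swap := leq_imset_card swap (forward_pairs A).
  have: #|setX A A| <= #|forward_pairs A :|: swap @: forward_pairs A :|: same|.
    apply/subset_leq_card/subsetP=> -[u v] uvA.
    have := uvA; rewrite !inE /= => /andP[uA vA]; rewrite uA vA /=.
    case: (ltngtP u.1 v.1) => [||/val_inj->]; rewrite ?eqxx ?orbT //.
    move=> vu; apply/orP; left; apply/imsetP; exists (v, u) => //.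
    by rewrite !inE /= uA vA.
  move/leq_trans; apply; apply: leq_trans (leq_card_setU _ _) _.
  rewrite leq_add2r; apply: leq_trans (leq_card_setU _ _) _.
  by rewrite leq_add2l.
rewrite cardsX; nia.
Qed.

Definition has_independent : {set sample} :=
  \bigcup_(A : {set V} | 2 * n <= #|A|)
    [set e | e \in ffun_on [predC forward_pairs A]].

Lemma card_sample : #|sample| = (K ^ 2 * n ^ 2) ^ M.
Proof. by rewrite card_ffun !card_prod !card_ord; congr (_ ^ _); lia. Qed.

(** Union bound over [2^(K n)] sets [A]: avoiding the forward pairs of [A] leaves at most
    [(K^2 - 1) n^2] values per draw. *)
Lemma card_has_independent :
  #|has_independent| <= 2 ^ (K * n) * ((K ^ 2).-1 * n ^ 2) ^ M.
Proof.
apply: (@leq_trans (\sum_(A : {set V}) ((K ^ 2).-1 * n ^ 2) ^ M)); last first.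
  rewrite sum_nat_const; apply: leq_mul => //.
  by rewrite -cardsT -powersetT card_powerset cardsT card_prod !card_ord.
rewrite /has_independent big_mkcond /=.
elim/big_ind2: _ => [|A a B b le1 le2|A _]; first by rewrite cards0.
  exact: leq_trans (leq_card_setU _ _) (leq_add le1 le2).
case: ifP => [/card_forward_pairs le_A|]; last by rewrite cards0.
rewrite cardsE card_ffun_on card_ord.
have le_C : #|[predC forward_pairs A]| <= (K ^ 2).-1 * n ^ 2.
  have := cardC (mem (forward_pairs A)); rewrite !card_prod !card_ord.
  set x := #|_|; set y := #|_| => e.
  have {}le_A : n * n <= x by [].
  case: (K ^ 2) (mulnn K) => [|k2] eK; nia.
by case: (M) => // M'; rewrite leq_exp2r.
Qed.

Definition dense_sets g (e : sample) : {set {set V}} :=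
  [set X : {set V} | (0 < #|X| <= g) && (#|X| <= #|[set i | e i \in setX X X]|)].

(** Choose [l] indices whose pairs fall inside [X], in at most [M^l] ways; each then has [l^2]
    values, and the other draws are free. *)
Lemma card_dense_samples (X : {set V}) l : #|X| = l -> l <= M ->
  #|[set e : sample | l <= #|[set i | e i \in setX X X]|]|
    <= M ^ l * ((l ^ 2) ^ l * (K ^ 2 * n ^ 2) ^ (M - l)).
Proof.
move=> card_X le_M; pose c := (l ^ 2) ^ l * (K ^ 2 * n ^ 2) ^ (M - l).
pose F (J : {set 'I_M}) (i : 'I_M) : pred (V * V) :=
  [pred uv | (i \in J) ==> (uv \in setX X X)].
apply: (@leq_trans #|\bigcup_(J : {set 'I_M} | #|J| == l)
                       [set e : sample | e \in family (F J)]|).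
  apply/subset_leq_card/subsetP=> e; rewrite inE => /exists_subset_card[J JS cJ].
  apply/bigcupP; exists J; first exact/eqP.
  rewrite inE; apply/familyP=> i; rewrite inE; apply/implyP=> /(subsetP JS).
  by rewrite inE.
apply: (@leq_trans (\sum_(J : {set 'I_M} | #|J| == l) c)); last first.
  rewrite sum_nat_cond_const leq_mul //.
  rewrite (_ : #|_| = 'C(M, l)) ?bin_leq_expn //.
  by rewrite -[M in 'C(M, _)]card_ord -card_draws cardsE; apply: eq_card.
elim/big_ind2: _ => [|A a B b le1 le2|J /eqP cJ]; first by rewrite cards0.
  exact: leq_trans (leq_card_setU _ _) (leq_add le1 le2).
rewrite cardsE card_family foldrE big_map /=.
rewrite big_enum /= (bigID (mem J)) /=.
rewrite (eq_bigr (fun=> l ^ 2)) => [|i iJ]; last first.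
  rewrite -card_X -mulnn -cardsX; apply: eq_card => uv; rewrite !inE.
  by rewrite (iJ : i \in J).
rewrite [X in _ * X](eq_bigr (fun=> K ^ 2 * n ^ 2)) => [|i iJ]; last first.
  rewrite (_ : #|_| = #|{: V * V}|); last first.
    by apply: eq_card => uv; rewrite !inE (negPf iJ).
  by rewrite !card_prod !card_ord; lia.
rewrite !prod_nat_const cJ.
rewrite (_ : #|_| = M - l) //.
apply/eqP; rewrite -(eqn_add2l l) subnKC // -{1}cJ.
by have := cardC (mem J); rewrite card_ord => ->.
Qed.

(** First moment: there are at most [(K n)^l] sets of size [l], and the powers of [n] cancel, so the
    mean number of dense sets is bounded independently of [n]. *)
Lemma sum_card_dense_sets g :
  \sum_e #|dense_sets g e| <= (\sum_(l < g.+1) (D * l ^ 2) ^ l) * #|sample|.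
Proof.
have -> : \sum_e #|dense_sets g e| = \sum_(X : {set V} | 0 < #|X| <= g)
    #|[set e : sample | #|X| <= #|[set i | e i \in setX X X]|]|.
  under eq_bigr do rewrite -sum1_card.
  under [RHS]eq_bigr do rewrite -sum1_card.
  rewrite (exchange_big_dep (fun X : {set V} => 0 < #|X| <= g)) /=; last first.
    by move=> e X _; rewrite inE => /andP[].
  apply: eq_bigr => X Xg; apply: eq_bigl => e.
  by rewrite !inE Xg.
rewrite (partition_big (fun X : {set V} => inord #|X| : 'I_g.+1) xpredT) //=.
rewrite big_distrl /=; apply: leq_sum => l _.
have [lM|Ml] := leqP l M; last first.
  rewrite big1 // => X /andP[/andP[_ Xg] /eqP lX]; apply: eq_card0 => e.
  have eX : #|X| = l by rewrite -lX inordK.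
  rewrite inE eX; apply/negbTE; rewrite -ltnNge; apply: leq_trans Ml.
  by rewrite ltnS (leq_trans (max_card _)) ?card_ord.
pose c := M ^ l * ((l ^ 2) ^ l * (K ^ 2 * n ^ 2) ^ (M - l)).
apply: (@leq_trans (\sum_(X : {set V} | #|X| == l) c)).
  rewrite big_mkcond [leqRHS]big_mkcond; apply: leq_sum => X _.
  case: ifP => // /andP[/andP[_ Xg] /eqP lX].
  have eX : #|X| = l by rewrite -lX inordK.
  by rewrite eX eqxx; apply: card_dense_samples.
rewrite sum_nat_cond_const (_ : #|_| = 'C(K * n, l)); last first.
  have := card_draws V l; rewrite card_prod !card_ord => <-.
  by rewrite cardsE; apply: eq_card.
rewrite card_sample -[in leqRHS](subnKC lM) expnD mulnA /c !mulnA leq_mul2r.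
apply/orP; right; apply: leq_trans (_ : (K * n) ^ l * M ^ l * (l ^ 2) ^ l <= _).
  by rewrite !leq_mul2r bin_leq_expn !orbT.
rewrite -!expnMn.
case: (posnP l) => [->|l_gt0]; first by rewrite !expn0.
rewrite leq_exp2r // /M; case: K => [|k]; nia.
Qed.

End RandomLayeredDigraph.

Lemma good_sample_exists K g : 1 < K -> exists n D (e : {ffun 'I_(D * n) -> _}),
  e \notin has_independent K n D /\ #|dense_sets g e| < n.
Proof.
(* This [q] beats the factor [2^(K n)] of the union bound by [4^n], so at most a quarter of the
   samples have an independent set. *)
move=> K_gt1; pose a := (K ^ 2).-1; pose q := 2 ^ (K + 2).
have K2_gt0 : 0 < K ^ 2 by rewrite expn_gt0 (ltnW K_gt1).
have a_gt0 : 0 < a by rewrite /a -mulnn; nia.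
have aS : a.+1 = K ^ 2 by rewrite prednK.
pose D := a * q; pose C := \sum_(l < g.+1) (D * l ^ 2) ^ l.
(* [C] does not depend on [n], so [n] may exceed [2 * C]; then fewer than half of the samples have
   [n] or more dense sets. *)
pose n := (2 * C).+1; pose sample := {ffun 'I_(D * n) -> 'I_K * 'I_n * ('I_K * 'I_n)}.
exists n, D.
have few_indep : 4 * #|has_independent K n D| <= #|{: sample}|.
  apply: leq_trans (leq_mul (leqnn 4) (card_has_independent K n D)) _.
  rewrite card_sample -/a -aS (expnMn a) (expnMn a.+1) !mulnA leq_mul2r.
  apply/orP; right.
  apply: (@leq_trans ((a ^ D * q) ^ n)); last first.
    by rewrite (expnM a.+1 D n) leq_exp2r // expn_ratio_unbounded.
  rewrite expnMn -expnM [leqRHS]mulnC leq_mul2r; apply/orP; right.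
  rewrite /q expnD expnMn -expnM mulnC leq_mul2l; apply/orP; right.
  by rewrite -{1}[4]expn1 leq_exp2l.
have sum_le := sum_card_dense_sets K n D g; rewrite -/C in sum_le.
have sample_gt0 : 0 < #|{: sample}|.
  by rewrite card_sample expn_gt0 muln_gt0 K2_gt0.
suff /existsP[e /andP[]] : [exists e,
    (e \notin has_independent K n D) && (#|dense_sets g e| < n)] by exists e.
rewrite -[X in is_true X]negbK negb_exists; apply/negP=> /forallP bad.
have : n * #|~: has_independent K n D| <= C * #|{: sample}|.
  apply: leq_trans sum_le; rewrite mulnC -sum_nat_const big_mkcond /=.
  apply: leq_sum => e _; have := bad e; rewrite inE negb_and -leqNgt.
  by case: (e \in _).
have := cardsC (has_independent K n D); move: few_indep sample_gt0.
rewrite -cardsT /n; move: #|_| #|_| #|_| => x y z; nia.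
Qed.

(** Ensures that the cycle edges leaving two distinct vertices differ as unordered pairs. *)
Lemma next_next_neq (T : eqType) (c : seq T) x :
  uniq c -> 2 < size c -> x \in c -> next c (next c x) != x.
Proof.
move=> uc sc /rot_to[i s e]; rewrite -!(next_rot i uc).
have us : uniq (rot i c) by rewrite rot_uniq.
have ss : 2 < size (rot i c) by rewrite size_rot.
case: s e us ss => [|y [|z s]] -> //= /and3P[+ _ _] _.
rewrite !inE !negb_or => /and3P[xy xz _].
by rewrite eqxx [y == x]eq_sym (negPf xy) eqxx eq_sym.
Qed.

(* Distinct edges of the cycle occur at distinct sample indices, so a cycle is
   a vertex set containing at least as many sampled pairs as vertices. *)
Lemma cycle_dense (T I : finType) (e : I -> T * T) (c : seq T) : 2 < size c ->
    ucycle (sym_closure (fun u v => [exists i, e i == (u, v)])) c ->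
  #|[set x in c]| <= #|[set i | e i \in setX [set x in c] [set x in c]]|.
Proof.
move=> c_gt2 /andP[cyc uc].
have idx x : exists i, x \in c -> e i = (x, next c x) \/ e i = (next c x, x).
  case: (boolP (x \in c)) => [xc|xc]; last first.
    case: c c_gt2 cyc {uc xc} => // y c _ cyc.
    have := next_cycle cyc (mem_head y c).
    by case/orP => /existsP[i _]; exists i.
  have /orP[] := next_cycle cyc xc => /existsP[i /eqP ei]; exists i => _.
    by left.
  by right.
have [f fP] := fin_all_exists idx.
have f_inj : {in [set x in c] &, injective f}.
  move=> x y; rewrite !inE => xc yc fxy; have nn := next_next_neq uc c_gt2 xc.
  have := fP x xc; have := fP y yc; rewrite fxy.
  case=> -> [] [] // e1 e2; try by rewrite e1 ?e2.
  - by move: nn; rewrite -e1 e2 eqxx.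
  - by move: nn; rewrite -e2 e1 eqxx.
rewrite -(card_in_imset f_inj); apply/subset_leq_card/subsetP=> _ /imsetP[x + ->].
rewrite !inE => xc; have nc : next c x \in c by rewrite mem_next.
by case: (fP x xc) => ->; rewrite /= ?inE xc nc.
Qed.

(** Deletion method: removing one vertex of each dense set destroys all short cycles. Fewer than [n]
    vertices go, so one of [k] colour classes keeps [2 * n] vertices and contains a sampled forward
    pair. *)
Lemma sparse_layered_digraph k g :
  exists (V : finType) (arc : rel V) (lay : V -> nat),
    [/\ forall u v, arc u v -> lay u < lay v, forall u, lay u < 2 * k + 2,
        forall c : V -> 'I_k, exists u v, arc u v /\ c u = c v
      & forall c, 2 < size c <= g -> ~ ucycle (sym_closure arc) c].
Proof.
set K := 2 * k + 2; have [|n [D [e [indep sparse]]]] := @good_sample_exists K g.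
  by rewrite /K addn2.
pose V0 := ('I_K * 'I_n)%type.
have v0 : V0.
  by split; [exists 0; rewrite /K addn2 | exists 0; apply: leq_trans sparse].
(* The default [v0] serves only the empty set, which is not dense. *)
pose rep (X : {set V0}) := odflt v0 [pick x in X].
pose Y := rep @: dense_sets g e.
have cardY : #|Y| < n by apply: leq_ltn_trans (leq_imset_card _ _) sparse.
pose V := {v : V0 | v \notin Y}.
pose arc0 : rel V0 := fun u v => [exists i, e i == (u, v)].
pose arc : rel V := fun u v => arc0 (val u) (val v) && ((val u).1 < (val v).1).
exists V, arc, (fun v : V => nat_of_ord (val v).1); split.
- by move=> u v /andP[].
- by move=> u.
- move=> c.
  pose cls j := [set v : V0 | if insub v is Some v' then c v' == j else false].
  have [j le_j] : exists j, 2 * n <= #|cls j|.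
    apply/existsP; rewrite -[X in is_true X]negbK negb_exists.
    apply/negP=> /forallP small.
    have : #|~: Y| <= \sum_j #|cls j|.
      have : ~: Y \subset \bigcup_j cls j.
        apply/subsetP=> v; rewrite inE => vY; apply/bigcupP.
        by exists (c (exist _ v vY)) => //; rewrite inE insubT.
      move/subset_leq_card/leq_trans; apply.
      elim/big_ind2: _ => [|A a B b le1 le2|//]; first by rewrite cards0.
      exact: leq_trans (leq_card_setU _ _) (leq_add le1 le2).
    have : \sum_j #|cls j| <= \sum_(j < k) 2 * n.
      by apply: leq_sum => j _; have := small j; rewrite -ltnNge => /ltnW.
    rewrite sum_nat_const card_ord; have := cardsC Y; rewrite card_prod !card_ord.
    move: cardY; rewrite /K; move: #|Y| #|~: Y| (\sum_j _) => y y' s; nia.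
  have [i ei] : exists i, e i \in forward_pairs (cls j).
    apply/existsP; apply: contraR indep; rewrite negb_exists => /forallP ne.
    by apply/bigcupP; exists (cls j) => //; rewrite inE; apply/ffun_onP.
  move: ei; case ei: (e i) => [u v]; rewrite !inE /= -andbA.
  case: insubP => //= u' _ eu; case: insubP => [v' _ ev|]; last by rewrite andbF.
  case/and3P=> /eqP cu /eqP cv lt; exists u', v'; rewrite cu cv; split=> //.
  by rewrite /arc /= eu ev lt andbT; apply/existsP; exists i; rewrite ei.
- move=> c /andP[c_gt2 c_le] /andP[cyc uc].
  have uc' : uniq (map val c) by rewrite map_inj_uniq //; exact: val_inj.
  have dense : [set x in map val c] \in dense_sets g e.
    rewrite inE; apply/andP; split.
      by rewrite cardsE (card_uniqP uc') size_map c_le andbT; case: (c) c_gt2.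
    apply: cycle_dense; first by rewrite size_map.
    apply/andP; split=> //; rewrite cycle_map; apply: sub_cycle cyc => u v /=.
    by case/orP=> /andP[uv _]; apply/orP; [left|right]; exact: uv.
  have : rep [set x in map val c] \in map val c.
    rewrite /rep; case: pickP => [x|/=]; first by rewrite inE.
    by case: (c) c_gt2 => // x s _ /(_ (val x)); rewrite !inE eqxx.
  case/mapP=> x _ ex; have := valP x; rewrite -ex => /negP; apply.
  exact: imset_f.
Qed.

(** * Adjacency by path length modulo p *)

Section ResidueGraph.
Variables (V : finType) (arc : rel V) (lay : V -> nat) (K p : nat).
Hypothesis arc_lay : forall u v, arc u v -> lay u < lay v.
Hypothesis lay_lt : forall u, lay u < K.

(** Layers keep walk lengths below [K], so bounding [l] loses nothing and makes the relation
    boolean. *)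
Definition residue_adj : rel V := fun u v =>
  [exists l : 'I_K, ~~ (p %| l) && (walk arc l u v || walk arc l v u)].

Lemma walk_length_lt l u v : walk arc l u v -> l < K.
Proof. by move/(walk_lay arc_lay); have := lay_lt v; lia. Qed.

Lemma residue_adjP u v :
  reflect (exists2 l, ~~ (p %| l) & walk arc l u v \/ walk arc l v u)
          (residue_adj u v).
Proof.
apply: (iffP existsP) => [[l /andP[pl /orP wl]]|[l pl wl]]; first by exists l.
have lK : l < K by case: wl => /walk_length_lt.
by exists (Ordinal lK); rewrite /= pl; apply/orP.
Qed.

Lemma residue_adj_sym : symmetric residue_adj.
Proof. by move=> u v; apply/eq_existsb=> l; rewrite orbC. Qed.

Lemma residue_adj_irrefl : irreflexive residue_adj.
Proof.
move=> u; apply/residue_adjP=> -[[|l] pl wl]; first by rewrite dvdn0 in pl.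
by case: wl => /(walk_lay arc_lay); lia.
Qed.

Definition residue_graph : sgraph := SGraph residue_adj_sym residue_adj_irrefl.

Section Embedded.
Variables (G : sgraph) (phi : G -> V).
Hypothesis edge_phi : forall u v, edge u v = residue_adj (phi u) (phi v).

(** Walks of nonzero length change layer, so layers colour properly. This serves subgraphs of clique
    number at least [p]. *)
Lemma residue_chi_leq_layers : chi G <= K.
Proof.
apply: chi_leq; rewrite -[K]card_ord.
apply: (colorable_map (c := fun u => Ordinal (lay_lt (phi u)))) => u v.
rewrite edge_phi => uv; apply/eqP=> /(congr1 val) /= e.
case/residue_adjP: uv => -[|l]; first by rewrite dvdn0.
by move=> _ [] /(walk_lay arc_lay); lia.
Qed.

Lemma residue_omega_leq g :
    (forall c, 2 < size c <= g -> ~ ucycle (sym_closure arc) c) ->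
    2 * K <= g -> 0 < p -> omega G <= p.
Proof.
move=> no_cyc leK p_gt0; apply/bigmax_leqP=> S /forallP Scl.
have [->|[v1 v1S]] := set_0Vmem S; first by rewrite cards0.
have [v0 v0S v0min] : exists2 v0, v0 \in S &
    forall v, v \in S -> lay (phi v0) <= lay (phi v).
  by case: (arg_minnP (fun v => lay (phi v)) v1S) => v0; exists v0.
have adj u v : u \in S -> v \in S -> u != v -> lay (phi u) <= lay (phi v) ->
    exists2 l, ~~ (p %| l) & walk arc l (phi u) (phi v).
  move=> uS vS uv le; have /implyP/(_ uS)/forallP/(_ v)/implyP/(_ vS) := Scl u.
  move/implyP/(_ uv); rewrite edge_phi => /residue_adjP[l pl [|wl]]; exists l => //.
  case: l pl wl => [|l] pl wl; first by rewrite dvdn0 in pl.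
  by have := walk_lay arc_lay wl; lia.
(* On [S] this is the length of a walk from [v0]; the default 0 is right for [v0] itself. *)
pose d v := if [pick l : 'I_K | walk arc l (phi v0) (phi v)] is Some l
            then val l else 0.
have dP v : v \in S -> walk arc (d v) (phi v0) (phi v).
  move=> vS; rewrite /d; case: pickP => // no_l.
  have [->|vv0] := eqVneq v v0; first exact: walk0.
  have v0v : v0 != v by rewrite eq_sym.
  have [l _ wl] := adj v0 v v0S vS v0v (v0min v vS).
  by have := no_l (Ordinal (walk_length_lt wl)); rewrite /= wl.
pose f v := Ordinal (ltn_pmod (d v) p_gt0).
have f_inj : {in S &, injective f}.
  move=> u v uS vS /(congr1 val) /= duv; apply/eqP/negPn/negP=> uv.
  wlog le_uv : u v uS vS duv uv / lay (phi u) <= lay (phi v).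
    move=> H; have /orP[] := leq_total (lay (phi u)) (lay (phi v)); first exact: H.
    by apply: H; rewrite // eq_sym.
  have [l /negP pl wl] := adj u v uS vS uv le_uv; case: pl.
  have wdl := walk_cat (dP u uS) wl.
  have e : d v = d u + l.
    apply: (walk_unique arc_lay no_cyc (dP v vS) wdl).
    by have := walk_length_lt wdl; have := walk_length_lt (dP v vS); lia.
  by rewrite /dvdn -[0](mod0n p) -(eqn_modDl (d u)) -e addn0; apply/eqP.
by rewrite -(card_in_imset f_inj) (leq_trans (max_card _)) ?card_ord.
Qed.

(** * Colouring subgraphs of clique number below [p] *)

Section BoundedClique.
Variable m : nat.
Hypotheses (p_prime : prime p) (omega_m : omega G = m) (m_lt_p : m < p).

(* Records the position of [l / p] modulo 1 among the fractions with
   denominator at most [m]. *)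
Definition farey_class (l : nat) : {ffun 'I_m.+1 -> 'I_m.+1} :=
  [ffun j : 'I_m.+1 => inord (j * (l %% p) %/ p)].

(** The lower bound is strict because the prime [p] divides neither [l] nor [t], as
    [0 < t <= m < p]. *)
Lemma farey_class_bounds l (t : 'I_m.+1) : ~~ (p %| l) -> 0 < t ->
  p * farey_class l t < t * (l %% p) < p * (farey_class l t).+1.
Proof.
move=> pl t_gt0; have p_gt0 := prime_gt0 p_prime.
have r_lt := ltn_pmod l p_gt0; have tm := ltn_ord t.
have lt : t * (l %% p) %/ p < m.+1 by rewrite ltn_divLR //; nia.
rewrite ffunE inordK // mulnC [p * _.+1]mulnC ltn_ceil // andbT.
rewrite ltn_neqAle leq_divM andbT; apply/negP=> /eqP e.
have : p %| t * (l %% p) by rewrite -e dvdn_mull.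
rewrite Euclid_dvdM // => /orP[|]; first by move/dvdn_leq; lia.
by rewrite /dvdn modn_mod; apply/negP.
Qed.

Definition class_arc (c : {ffun 'I_m.+1 -> 'I_m.+1}) : rel G := fun u v =>
  [exists l : 'I_K, [&& ~~ (p %| l), farey_class l == c
                      & walk arc l (phi u) (phi v)]].

(* If every step [r_i] satisfies [a p < t r_i < (a + 1) p], then so does the
   average of [t] steps, whence their sum is not divisible by [p]. *)
Lemma class_path_walk c u q : path (class_arc c) u q -> 0 < size q <= m ->
  exists2 l, ~~ (p %| l) & walk arc l (phi u) (phi (last u q)).
Proof.
move=> uq /andP[q_gt0 q_le]; have q_lt : size q < m.+1 by [].
pose t := Ordinal q_lt; pose a : nat := c t.
have t_gt0 : 0 < t by [].
(* [r] adds up the residues of the steps; each strict bound gains one unit, whence the summands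
   [size q]. *)
have: exists l r, [/\ walk arc l (phi u) (phi (last u q)), l = r %[mod p],
    size q * (p * a) + size q <= t * r & t * r + size q <= size q * (p * a.+1)].
  move: (t) t_gt0 @a => {q_gt0 q_le q_lt}t t_gt0 a.
  elim: q u uq => [|v q IH] u /=; first by exists 0, 0; rewrite walk0 !muln0.
  case/andP=> /existsP[l /and3P[pl /eqP lc uv]] /IH[l' [r [wl' lr lo hi]]].
  exists (l + l'), (l %% p + r); split; first exact: walk_cat wl'.
  - by rewrite -modnDmr lr modnDmr modnDml.
  - by have := farey_class_bounds pl t_gt0; rewrite lc -/a; lia.
  - by have := farey_class_bounds pl t_gt0; rewrite lc -/a; lia.
case=> l [r [wl lr lo hi]]; exists l => //.
rewrite /dvdn lr -/(dvdn p r); apply/negP=> /dvdnP[k ek].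
(* As [t = size q], cancelling it puts [r] strictly between consecutive multiples of [p]. *)
have {}lo : p * a < r by move: lo; rewrite /= -mulnSr leq_pmul2l.
have {}hi : r < p * a.+1.
  have : size q * r.+1 <= size q * (p * a.+1) by rewrite mulnS addnC.
  by rewrite leq_pmul2l.
move: lo hi; rewrite ek mulnC ltn_mul2r [_ * a.+1]mulnC ltn_mul2r.
by move=> /andP[_ lo] /andP[_]; lia.
Qed.

(** By [class_path_walk] the first vertex is adjacent to every later one; irreflexivity then also
    rules out repeated vertices. *)
Lemma class_path_clique c u q : path (class_arc c) u q -> size q <= m ->
  is_clique [set x in u :: q] /\ #|[set x in u :: q]| = (size q).+1.
Proof.
elim: q u => [|v q IH] u uq le_m.
  rewrite set_cons set_nil setU0 cards1; split=> //.
  apply/forall_inP=> x /set1P->; apply/forall_inP=> y /set1P->.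
  by rewrite eqxx.
have /= /andP[_ /IH[|vcl vcard]] := uq; first exact: ltnW.
have adj x : x \in v :: q -> edge u x.
  move=> xq; rewrite edge_phi; apply/residue_adjP.
  case/path.splitP: xq uq le_m => r r'; rewrite cat_path size_cat size_rcons.
  case/andP=> ur _ le; have [|l pl] := class_path_walk ur.
    by rewrite size_rcons; lia.
  by rewrite last_rcons; exists l; [|left].
rewrite set_cons cardsU1 inE vcard; split; last first.
  by case: (boolP (u \in v :: q)) => // /adj; rewrite edge_irrefl.
apply/forall_inP=> x; rewrite in_setU1 => xP.
apply/forall_inP=> y; rewrite in_setU1 => yP; apply/implyP=> xy.
case/predU1P: xP xy => [->|xP]; case/predU1P: yP => [->|yP] xy.
- by rewrite eqxx in xy.
- by apply: adj; rewrite inE in yP.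
- by rewrite edge_sym; apply: adj; rewrite inE in xP.
- by have /forall_inP/(_ x xP)/forall_inP/(_ y yP)/implyP/(_ xy) := vcl.
Qed.

(** A Gallai-Roy colouring for each class, with the set of chain lengths up to [m] in place of the
    longest one. *)
Definition chain_color (u : G) :
    {ffun {ffun 'I_m.+1 -> 'I_m.+1} -> {set 'I_m.+1}} :=
  [ffun c => [set t : 'I_m.+1 | [exists v, walk (class_arc c) t v u]]].

(* Otherwise chains of every length [t <= m] would end at [u], the last of
   which spans a clique on [m + 1] vertices. *)
Lemma class_arc_color c u v : class_arc c u v -> chain_color u != chain_color v.
Proof.
move=> uv; apply/eqP=> /ffunP/(_ c)/setP; rewrite !ffunE => e.
have ch t : t <= m -> exists w, walk (class_arc c) t w u.
  elim: t => [|t IH] lt; first by exists u; apply: walk0.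
  have [|w wt] := IH; first exact: ltnW.
  (* Appending [v] to a chain ending at [u] gives one of length [t + 1] ending at [v]; equal colours
     bring such a chain back to [u]. *)
  apply/existsP; have := e (Ordinal (lt : t.+1 < m.+1)); rewrite !inE /= => ->.
  by apply/existsP; exists w; rewrite -addn1 (walk_cat wt) ?walk1.
have [//|w /walkP[q [wq _ sq]]] := ch m.
have [|cl card_cl] := class_path_clique wq; first by rewrite sq.
by have := clique_leq_omega cl; rewrite card_cl omega_m sq ltnn.
Qed.

Lemma chain_color_proper u v : edge u v -> chain_color u != chain_color v.
Proof.
rewrite edge_phi => /residue_adjP[l pl [] wl]; last rewrite eq_sym.
all: apply: (class_arc_color (c := farey_class l)); apply/existsP.
all: by exists (Ordinal (walk_length_lt wl)); rewrite /= pl eqxx.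
Qed.

End BoundedClique.

(** The number of colours of [chain_color]; it does not involve [p], so it serves all primes at
    once. *)
Definition small_clique_bound (m : nat) :=
  #|{ffun {ffun 'I_m.+1 -> 'I_m.+1} -> {set 'I_m.+1}}|.

Lemma residue_chi_leq_omega : prime p -> omega G < p ->
  chi G <= small_clique_bound (omega G).
Proof.
move=> p_prime lt_p; apply/chi_leq/colorable_map => u v.
exact: (chain_color_proper p_prime erefl lt_p).
Qed.

End Embedded.
End ResidueGraph.

(** * Small induced subgraphs are willows *)

(* An oriented forest becomes an oriented tree after adding a sink [None] that
   receives one arc from every component; no directed path between old vertices
   is created. *)
Section SinkExtension.
Variables (U : finType) (arc : rel U).
Hypothesis arc_asym : forall x y, ~~ (arc x y && arc y x).
Hypothesis acyclic_arc : forall c, 2 < size c -> ~ ucycle (sym_closure arc) c.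

Definition sink_arc : rel (option U) := fun a b =>
  match a, b with
  | Some x, Some y => arc x y
  | Some x, None => fingraph.root (sym_closure arc) x == x
  | None, _ => false
  end.

Lemma sink_irrefl : irreflexive (sym_closure sink_arc).
Proof.
case=> [x|] //; rewrite /sym_closure /= orbb.
by have := arc_asym x x; rewrite andbb => /negPf.
Qed.

Definition sink_tree : sgraph :=
  SGraph (@sym_closure_sym _ sink_arc) sink_irrefl.

Lemma sink_path x q :
  path (sym_closure sink_arc) (Some x) (map Some q)
  = path (sym_closure arc) x q.
Proof. by rewrite path_map. Qed.

Lemma notin_None (s : seq (option U)) : None \notin s -> exists r, s = map Some r.
Proof.
elim: s => [|[x|] s IH] //; first by exists [::].
by rewrite inE /= => /IH[r ->]; exists (x :: r).
Qed.

(** Every vertex reaches [None] through the root of its component. A cycle through [None] would meet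
    two distinct roots of one component; any other cycle lies in the forest. *)
Lemma sink_is_tree : is_tree sink_tree.
Proof.
have csym : connect_sym (sym_closure sink_arc).
  exact/sym_connect_sym/sym_closure_sym.
have toN (a : option U) : connect (sym_closure sink_arc) a None.
  case: a => [x|]; last exact: connect0.
  have /connectP[q xq lq] := connect_root (sym_closure arc) x.
  apply: (@connect_trans _ _ (Some (fingraph.root (sym_closure arc) x))).
    by apply/connectP; exists (map Some q); rewrite ?sink_path // last_map -lq.
  apply: connect1; rewrite /sym_closure /=.
  by rewrite root_root ?eqxx //; exact/sym_connect_sym/sym_closure_sym.
split; first by rewrite card_option.
  by move=> x y; apply: connect_trans (toN x) _; rewrite csym; apply: toN.
move=> c c_gt2 ucyc.
case: (boolP (None \in (c : seq (option U)))) => [|/notin_None[r ec]].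
  case/rot_to=> i s ec.
  have sz : 2 < size (None :: s) by rewrite -ec size_rot.
  have : ucycle (sym_closure sink_arc) (None :: s) by rewrite -ec rot_ucycle.
  case/andP=> cyc /andP[/notin_None[r er] us]; move: cyc us sz.
  rewrite {}er {ec}; case: r => [|x [|y r]] // cyc us _.
  move: cyc; rewrite (cycle_path None) /= last_map => /and3P[rl rx].
  rewrite [X in _ && X](sink_path y r) => /andP[xy yr].
  have /eqP er : fingraph.root (sym_closure arc) x
                 == fingraph.root (sym_closure arc) (last y r).
    rewrite root_connect; last exact/sym_connect_sym/sym_closure_sym.
    by apply/connectP; exists (y :: r); rewrite //= yr andbT.
  move: rx rl er us; rewrite /sym_closure /= !orbF => /eqP-> /eqP-> ->.
  by rewrite -map_cons mem_map ?mem_last // => ? ? [].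
move: c_gt2 ucyc; rewrite ec size_map => r_gt2 /andP[cyc].
rewrite map_inj_uniq => [ur|? ? []//]; apply: (acyclic_arc r_gt2).
apply/andP; split=> //; case: (r) cyc => //= x q.
by rewrite -map_rcons (sink_path x).
Qed.

Lemma sink_is_orientation : is_orientation (sink_arc : rel sink_tree).
Proof. by case=> [x|] [y|]; split; rewrite //= ?andbF ?arc_asym. Qed.

(** No arc leaves [None], so a directed path ending at an old vertex avoids it. *)
Lemma sink_arc_path x y q : path sink_arc (Some x) q -> last (Some x) q = Some y ->
  exists r, [/\ q = map Some r, path arc x r & last x r = y].
Proof.
elim: q x => [|[z|] q IH] x /=.
- by move=> _ [->]; exists [::].
- case/andP=> xz /IH H /H[r [-> zr lr]]; exists (z :: r).
  by rewrite /= xz.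
- by case: q {IH} => [|a q] /= /andP[_].
Qed.

End SinkExtension.

Section SmallSubgraphs.
Variables (V : finType) (arc : rel V) (lay : V -> nat) (K p g : nat).
Hypothesis arc_lay : forall u v, arc u v -> lay u < lay v.
Hypothesis lay_lt : forall u, lay u < K.
Hypothesis girth_arc :
  forall c, 2 < size c <= g -> ~ ucycle (sym_closure arc) c.

Lemma residue_n_willow (H : sgraph) (phi : H -> V) : injective phi ->
    (forall u v, edge u v = residue_adj arc K p (phi u) (phi v)) ->
    #|H| + #|H| ^ 2 * K <= g -> n_willow p H.
Proof.
move=> phi_inj edge_phi le_g.
pose witness (uv : H * H) q := size q <= K /\ (edge uv.1 uv.2 ->
  ~~ (p %| size q) /\ (path arc (phi uv.1) q /\ last (phi uv.1) q = phi uv.2 \/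
                       path arc (phi uv.2) q /\ last (phi uv.2) q = phi uv.1)).
have [Q QP] : exists Q, forall uv, witness uv (Q uv).
  apply: (@fin_all_exists _ (fun=> seq V)) => -[u v]; rewrite /witness /=.
  case: (boolP (edge u v)) => [|_]; last by exists [::].
  rewrite edge_phi => /(residue_adjP _ arc_lay lay_lt)[l pl wl].
  have lK : l <= K by case: wl => /(walk_length_lt arc_lay lay_lt)/ltnW.
  case: wl => /walkP[q [qP ql sq]]; exists q; rewrite sq; split=> // _.
    by split=> //; left.
  by split=> //; right.
(* The sequences [Q uv] omit their starting points, which [phi @: H] supplies. *)
pose X := phi @: H :|: \bigcup_uv [set x in Q uv].
have card_X : #|X| <= g.
  apply: leq_trans le_g; apply: leq_trans (leq_card_setU _ _) _.
  apply: leq_add; first exact: leq_imset_card.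
  have -> : #|H| ^ 2 = #|{: H * H}| by rewrite card_prod mulnn.
  rewrite -sum_nat_const; elim/big_ind2: _ => [|a A b B le1 le2|uv _].
  - by rewrite cards0.
  - exact: leq_trans (leq_card_setU _ _) (leq_add le1 le2).
  - apply: leq_trans (QP uv).1; rewrite cardsE; exact: card_size.
pose U := {x : V | x \in X}.
(* All arcs inside [X] are kept: a cycle of them has at most [g] vertices, which the girth
   forbids. *)
pose arcU : rel U := fun x y => arc (val x) (val y).
have asymU x y : ~~ (arcU x y && arcU y x).
  by apply/negP=> /andP[/arc_lay + /arc_lay]; lia.
have acycU (c : seq U) : 2 < size c -> ~ ucycle (sym_closure arcU) c.
  move=> c_gt2 /andP[cyc uc]; apply: (@girth_arc (map val c)).
    rewrite size_map c_gt2 (leq_trans _ card_X) // -(size_map val).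
    have /card_uniqP <- : uniq (map val c) by rewrite map_inj_uniq //; exact: val_inj.
    by apply/subset_leq_card/subsetP=> _ /mapP[x _ ->]; exact: valP.
  apply/andP; split; last by rewrite map_inj_uniq //; exact: val_inj.
  by rewrite cycle_map.
have phiX u : phi u \in X by rewrite inE imset_f.
pose psi u : U := exist _ (phi u) (phiX u).
exists (sink_tree asymU), (sink_arc arcU), (fun u => Some (psi u)).
split; [exact: sink_is_tree | exact: sink_is_orientation | by move=> u v [/phi_inj] |].
have lift u v q : path arc (phi u) q -> last (phi u) q = phi v ->
    {subset q <= X} -> dipath_length (sink_arc arcU)
      (Some (psi u)) (Some (psi v)) (size q).
  move=> uq lq qX.
  have [r er] : exists r : seq U, q = map val r.
    elim: (q) qX => [|x s IH] sX; first by exists [::].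
    have [|r ->] := IH; first by move=> z zs; apply: sX; rewrite inE zs orbT.
    by exists (exist _ x (sX x (mem_head _ _)) :: r).
  exists (map Some r); split.
  - by rewrite path_map; move: uq; rewrite er -[phi u]/(val (psi u)) path_map.
  - rewrite -map_cons map_inj_uniq => [|? ? []//].
    by rewrite -(map_inj_uniq val_inj) /= -er; exact: path_uniq arc_lay _ _ uq.
  - by rewrite last_map; congr Some; apply: val_inj; rewrite -last_map -er.
  - by rewrite er !size_map.
have lower u v l : dipath_length (sink_arc arcU)
      (Some (psi u)) (Some (psi v)) l ->
    walk arc l (phi u) (phi v).
  case=> q [uq _ lq <-]; have [r [-> ur lr]] := sink_arc_path uq lq.
  apply/walkP; exists (map val r); rewrite !size_map; split=> //.
    by rewrite -[phi u]/(val (psi u)) path_map.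
  by rewrite -[phi u]/(val (psi u)) last_map lr.
move=> u v _; split=> [uv|[l pl [] /lower wl]].
- have [_ /(_ uv)[pq]] := QP (u, v).
  have sub : {subset Q (u, v) <= X}.
    move=> x xq; rewrite inE; apply/orP; right.
    by apply/bigcupP; exists (u, v) => //; rewrite inE.
  by case=> -[/= pQ lQ]; exists (size (Q (u, v))) => //; [left|right]; apply: lift.
- by rewrite edge_phi; apply/(residue_adjP _ arc_lay lay_lt); exists l => //; left.
- by rewrite edge_phi; apply/(residue_adjP _ arc_lay lay_lt); exists l => //; right.
Qed.

End SmallSubgraphs.

(** * Separation from polynomial chi-boundedness *)

(** The first clause yields freeness, the next two a bound on [chi] uniform in [p], the last two the
    superpolynomial gap. *)
Definition separating_graph (N p : nat) (W : sgraph) : Prop :=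
  [/\ forall (S : {set W}) (H : sgraph),
        #|H| <= N -> isomorphic (induced S) H -> willow H,
      forall S : {set W}, omega (induced S) < p ->
        chi (induced S) <= small_clique_bound (omega (induced S)),
      forall S : {set W}, chi (induced S) <= 2 * p ^ p + 2,
      omega (induced [set: W]) <= p
    & p ^ p < chi (induced [set: W])].

Lemma separating_graph_exists N p : prime p -> exists W, separating_graph N p W.
Proof.
(* In [g], the part [N + N^2 * K] serves the willow subgraphs and [2 * K] the uniqueness of
   paths. *)
move=> p_prime; set K := 2 * p ^ p + 2; set g := N + N ^ 2 * K + 2 * K.
have [V [arc [lay [arc_lay lay_lt uncol girth]]]] :=
  sparse_layered_digraph (p ^ p) g.
pose W := residue_graph p arc_lay lay_lt.
have val_edge (S : {set W}) (u v : induced S) :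
  edge u v = residue_adj arc K p (val u) (val v) by [].
exists W; split.
- move=> S H cardH [f [f' fK f'K] f_edge]; exists p; first exact: prime_gt0.
  apply: (residue_n_willow (g := g) arc_lay lay_lt girth
           (phi := fun x => val (f' x))).
  + by move=> x y /val_inj /(can_inj f'K).
  + by move=> u v; rewrite -val_edge -f_edge !f'K.
  + rewrite /g -/K; apply: leq_trans (leq_addr _ _); apply: leq_add => //.
    by rewrite leq_mul2r leq_sqr cardH orbT.
- by move=> S; apply: (residue_chi_leq_omega arc_lay lay_lt (val_edge S)).
- by move=> S; apply: (residue_chi_leq_layers arc_lay lay_lt (val_edge S)).
- apply: (residue_omega_leq arc_lay lay_lt (val_edge _) girth).
    by rewrite /g leq_addl.
  exact: prime_gt0.
- rewrite ltnNge; apply/negP=> /chi_leqP[c cP].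
  pose lift (v : W) : induced [set: W] := exist _ v (in_setT v).
  (* Arcs are walks of length 1, hence edges of [W], so a proper colouring of [W] would properly
     colour the digraph. *)
  have [u [v [uv cuv]]] := uncol (fun v => c (lift v)).
  suff /cP : edge (lift u) (lift v) by rewrite cuv eqxx.
  rewrite val_edge; apply/(residue_adjP _ arc_lay lay_lt); exists 1.
    by rewrite dvdn1; have := prime_gt1 p_prime; case: (p) => [|[]].
  by left; apply: walk1.
Qed.

(** Each [m^i] with [i < size q] is at most [p^(size q)]; [B] is a natural number above the sum of
    the absolute values of the coefficients. *)
Lemma poly_nat_bound (q : {poly Rdefinitions.R}) :
  exists B : nat, forall m p : nat, m <= p -> 0 < p ->
    (q.[m%:R] <= (B * p ^ size q)%:R)%R.
Proof.
pose C := (\sum_(i < size q) `|q`_i|)%R.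
have C_ge0 : (0 <= C)%R by apply: sumr_ge0 => i _; apply: normr_ge0.
exists (Num.bound C) => m p le_mp p_gt0.
apply: (@le_trans _ _ (C * (p ^ size q)%:R))%R; last first.
  rewrite natrM ler_wpM2r ?ler0n //; exact/ltW/archi_boundP.
rewrite horner_coef mulr_suml; apply: ler_sum => i _.
apply: le_trans (ler_norm _) _; rewrite normrM ler_wpM2l // ger0_norm ?exprn_ge0 //.
rewrite -natrX ler_nat; apply: (@leq_trans (p ^ i)).
  by case: (nat_of_ord i) => // j; rewrite leq_exp2r.
by rewrite leq_pexp2l // ltnW.
Qed.

Theorem theorem8p2 (F : seq sgraph)
    (hF : forall H : sgraph, List.In H F -> ~ willow H) :
  ~ pollyanna (free_class (fun H : sgraph => List.In H F)).
Proof.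
have [N NP] : exists N, forall H : sgraph, List.In H F -> #|H| <= N.
  elim: (F) => [|H0 F0 [N NP]]; first by exists 0.
  exists (maxn #|H0| N) => H /= [<-|/NP]; first exact: leq_maxl.
  by move/leq_trans; apply; apply: leq_maxr.
pose C' : graph_class := fun W => exists2 p, prime p & separating_graph N p W.
move=> /(_ C')[|q qP].
  (* If the clique number is at least [p], then the layer bound for [p] is a term of the sum;
     otherwise the first summand suffices. *)
  exists (fun m => small_clique_bound m + \sum_(p < m.+1) (2 * p ^ p + 2)).
  move=> W [p p_prime [_ small layers _ _]] S.
  have [/small le|le] := ltnP (omega (induced S)) p.
    exact: leq_trans le (leq_addr _ _).
  apply: leq_trans (layers S) (leq_trans _ (leq_addl _ _)).
  have lt : p < (omega (induced S)).+1 by [].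
  by rewrite (bigD1 (Ordinal lt)) //= leq_addr.
have [B BP] := poly_nat_bound q.
(* Then [B <= p^(p - size q)], hence [B * p^(size q) <= p^p]. *)
have [p lt_p p_prime] := prime_above (B + size q).
have p_gt0 := prime_gt0 p_prime.
have [W WP] := separating_graph_exists N p_prime.
have [small _ _ le_omega gt_chi] := WP.
have W_free : free_class (fun H => List.In H F) W.
  by case=> H [S [HF iso]]; apply: (hF H HF); apply: small iso; apply: NP.
have WC : C' W by exists p.
have := le_trans (qP W (conj W_free WC) setT) (BP _ _ le_omega p_gt0).
rewrite ler_nat => /(leq_trans gt_chi); rewrite ltnNge => /negP; apply.
rewrite -{3}(subnK (_ : size q <= p)) ?expnD ?leq_mul2r; last first.
  by apply: leq_trans (ltnW lt_p); apply: leq_addl.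
apply/orP; right; apply: (@leq_trans (p ^ 1)); first by rewrite expn1; lia.
by rewrite leq_pexp2l //; lia.
Qed.
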